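(* Let $\alpha>0$, $\beta>0$ and $\alpha_s\geq 0$ be real parameters and, for $\xi\in[0,2\pi]$, let $$G(\xi)=\begin{pmatrix}1-\omega_1 & -\mathbf{i}\omega_2\\ -\mathbf{i}\omega_2 & 1-\alpha_s\omega_1\end{pmatrix},\qquad \omega_1=4\alpha\beta\sin^2\frac{\xi}{2},\quad \omega_2=\beta\sin\xi .$$ Consider the two conditions (N) $\ \max_{0\leq\xi\leq 2\pi}\max_{l}\big|\lambda_l\big(G(\xi)\big)\big|\leq 1$, (C) $\ \max_{0\leq\xi\leq 2\pi}\max_{l}\lambda_l\big((G^*G)(\xi)\big)\leq 1$. Then: (1) if $0\leq\alpha_s\leq 1$, then (N) holds if and only if $$\beta\leq\min\Big\{(\alpha_s+1)\alpha,\ \frac{1}{2\alpha}\Big\},$$ and (C) holds if and only if $$\beta\leq\min\Big\{2\alpha_s\alpha,\ \frac{1}{2\alpha}\Big\};$$ (2) if $\alpha_s\geq 1$, then (N) holds if and only if $$\beta\leq\min\Big\{(\alpha_s+1)\alpha,\ \frac{1}{2\alpha_s\alpha}\Big\},$$ and (C) holds if and only if $$\beta\leq\min\Big\{2\alpha,\ \frac{1}{2\alpha_s\alpha}\Big\}.$$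
   Context: Here $\mathbf{i}$ is the imaginary unit, $G^*$ is the conjugate transpose of $G$, $(G^*G)(\xi)=G(\xi)^*G(\xi)$, and $\lambda_l(A)$ denote the eigenvalues of a square matrix $A$ (real and nonnegative for $A=(G^*G)(\xi)$). The matrix $G(\xi)$ is the amplification matrix (symbol, obtained by substituting $\mathbf{y}^m_k=e^{\mathbf{i}k\xi}\mathbf{v}^m(\xi)$) of the linearized explicit two-level finite-difference scheme based on the simplified (quasi-hydrodynamic) regularization, for $\mathbf{y}^m=(\rho^m\ u^m)^T$ on the mesh indexed by $k\in\mathbb{Z}$: $$\mathbf{y}^{m+1}_k=\begin{pmatrix}\alpha\beta&\frac{\beta}{2}\\ \frac{\beta}{2}&\alpha_s\alpha\beta\end{pmatrix}\mathbf{y}^m_{k-1}+\begin{pmatrix}1-2\alpha\beta&0\\0&1-2\alpha_s\alpha\beta\end{pmatrix}\mathbf{y}^m_k+\begin{pmatrix}\alpha\beta&-\frac{\beta}{2}\\-\frac{\beta}{2}&\alpha_s\alpha\beta\end{pmatrix}\mathbf{y}^m_{k+1}.$$ *)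

(* Defs.v *)
From HB Require Import structures.
From mathcomp Require Import all_boot all_order all_algebra.
From mathcomp Require Import all_classical all_reals all_analysis.
From mathcomp Require Import complex.

Set Implicit Arguments.
Unset Strict Implicit.
Unset Printing Implicit Defensive.

Import Order.TTheory GRing.Theory Num.Theory.
Local Open Scope classical_set_scope.
Local Open Scope ring_scope.
Local Open Scope complex_scope.
Local Open Scope sesquilinear_scope.

(* On [R[i]], [z <= w] means that [w - z] is real and nonnegative. *)
Definition is_max (R : realType) (E : set R[i]) (m : R[i]) : Prop :=
  E m /\ ubound E m.

Definition spectrum (R : realType) (n : nat) (A : 'M[R[i]]_n) : set R[i] :=
  [set l | eigenvalue A l].

(* max over xi in [0, 2 pi] of the max over l of g (lambda_l (A xi)) is at most
   1; both maxima are required to be attained, [rho xi] being the inner one. *)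
Definition max_spectrum_le1 (R : realType) (n : nat) (g : R[i] -> R[i])
    (A : R -> 'M[R[i]]_n) : Prop :=
  exists2 rho : R -> R[i],
    forall xi, xi \in `[0, 2 * pi] -> is_max (g @` spectrum (A xi)) (rho xi) &
    exists2 M, is_max (rho @` `[0, 2 * pi]) M & M <= 1.

Definition omega1 (R : realType) (alpha beta xi : R) : R :=
  4 * alpha * beta * sin (xi / 2) ^+ 2.

Definition omega2 (R : realType) (beta xi : R) : R := beta * sin xi.

Definition amplification (R : realType) (alpha beta alpha_s xi : R) :
    'M[R[i]]_2 :=
  let w1 := omega1 alpha beta xi in
  let w2 := omega2 beta xi in
  \matrix_(i < 2, j < 2)
    if i == j then (if i == 0 then (1 - w1)%:C else (1 - alpha_s * w1)%:C)
    else - (w2 *i).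

Definition cond_N (R : realType) (alpha beta alpha_s : R) : Prop :=
  max_spectrum_le1 (fun l => `|l|) (amplification alpha beta alpha_s).

Definition cond_C (R : realType) (alpha beta alpha_s : R) : Prop :=
  max_spectrum_le1 id (fun xi =>
    (amplification alpha beta alpha_s xi) ^t* *m
    amplification alpha beta alpha_s xi).

(* Main.v *)
Require Import Defs.
From mathcomp Require Import all_boot all_order all_algebra.
From mathcomp Require Import all_classical all_reals all_analysis.
From mathcomp Require Import complex.
From mathcomp Require Import ring lra.
Import Order.TTheory GRing.Theory Num.Theory.
Local Open Scope ring_scope.

(** The proof rests on four observations.

    - At [xi = 0] the symbol is the identity matrix, so the two suprema are
      always at least 1: a maximum bounded by 1 is a maximum equal to 1, reached
      at [xi = 0].  Hence no continuity in [xi] is needed, and [cond_N] and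
      [cond_C] just say that every eigenvalue involved is at most 1 in modulus,
      resp. at most 1 ([max_spectrum_le1P]).

    - For a 2 x 2 matrix the eigenvalues are the roots of
      [l ^+ 2 - t * l + d], with [t] the trace and [d] the determinant.  For the
      symbol and for its Gram matrix both are real polynomials in
      [x = sin (xi / 2) ^+ 2], because [sin xi ^+ 2 = 4 * x * (1 - x)], and [x]
      runs over the whole of [[0, 1]].  The parameters enter only through
      [p = alpha * beta], [q = alpha_s * p] and [b = beta], symmetrically in
      [p] and [q].

    - For [cond_N] ([symbol_roots_le1P]): the product of the roots must be at
      most 1, and
      [1 - d = 4 * x * ((1 - x) * (p + q - b ^+ 2) + x * (p + q - 4 * p * q))].
      Letting [x] tend to 0 in the affine factor yields [b ^+ 2 <= p + q].  At
      [x = 1] the symbol is diagonal with entries [1 - 4 * p] and [1 - 4 * q],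
      which yields [2 * p <= 1] and [2 * q <= 1].  Conversely these three
      inequalities imply [d <= 1] and [0 <= 1 +/- t + d], which is the
      Schur-Jury criterion.

    - For [cond_C] ([gram_boundP]): put
      [D r = (1 - x) * (2 * r - b ^+ 2) + x * (2 * r * (1 - 2 * r))].  The
      diagonal entries of [1 - G^* G] are [4 * x * D p] and [4 * x * D q], and
      the Gram matrix has its eigenvalues at most 1 exactly when the trace and
      the determinant of [1 - G^* G] are nonnegative.  This forces both [D p]
      and [D q] to be nonnegative on [[0, 1]], that is
      [b ^+ 2 <= 2 * p], [b ^+ 2 <= 2 * q], [2 * p <= 1] and [2 * q <= 1].
      Conversely, under these inequalities the determinant divided by
      [(4 * x) ^+ 2] is a quadratic form in [1 - x] and [x] with nonnegative
      coefficients.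

    Dividing by [beta], and keeping the stronger of the two bounds in [p] and
    [q] according to the position of [alpha_s] with respect to 1, turns these
    inequalities into the stated ones. *)

(** * Maxima over spectra *)

Lemma real_seq_max (C : numDomainType) (T : eqType) (g : T -> C) (z : T)
    (s : seq T) :
  {in z :: s, forall y, g y \is Num.real} ->
  exists2 m, m \in z :: s & {in z :: s, forall y, g y <= g m}.
Proof.
elim: s z => [|y s IHs] z g_real.
  by exists z; rewrite ?inE // => y /[!inE] /eqP ->.
have [|m m_s m_max] := IHs y.
  by move=> u u_s; apply: g_real; rewrite inE u_s orbT.
have /orP[zm|mz] : (g z <= g m) || (g m <= g z).
  by apply: real_leVge; apply: g_real; rewrite !inE ?eqxx // -in_cons m_s orbT.
- exists m; first by rewrite inE m_s orbT.
  by move=> u /[!(@in_cons _ z)] /predU1P[->//|/m_max].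
- exists z; first exact: mem_head.
  move=> u /[!(@in_cons _ z)] /predU1P[->//|/m_max um].
  exact: le_trans um mz.
Qed.

Lemma eigenvalue_seq (F : closedFieldType) (n : nat) (A : 'M[F]_n.+1) :
  exists z s, eigenvalue A =i z :: s.
Proof.
have [r rE] := closed_field_poly_normal (char_poly A).
have eigE : eigenvalue A =i r.
  move=> l; rewrite -topredE /= eigenvalue_root_char rE.
  by rewrite (monicP (char_poly_monic A)) scale1r root_prod_XsubC.
have : r != [::].
  apply/eqP => r0; have := size_char_poly A.
  by rewrite rE r0 big_nil (monicP (char_poly_monic A)) scale1r size_poly1.
by case: r eigE {rE} => // z s eigE _; exists z, s.
Qed.

Lemma eigenvalue_scalar1 (F : fieldType) (n : nat) (l : F) :
  eigenvalue (1%:M : 'M[F]_n) l -> l = 1.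
Proof.
move=> /eigenvalueP[v + v_neq0]; rewrite mulmx1 -{1}[v]scale1r => /eqP.
rewrite -subr_eq0 -scalerBl scaler_eq0 (negPf v_neq0) orbF subr_eq0.
by move=> /eqP.
Qed.

(** Over a closed field the spectrum is finite and nonempty, so the inner
    maximum always exists once the values of [g] are real; the outer one is the
    value 1 taken at [xi = 0]. *)
Lemma max_spectrum_le1P (R : realType) (n : nat) (g : R[i] -> R[i])
    (A : R -> 'M[R[i]]_n.+1) :
    A 0 = 1%:M -> g 1 = 1 ->
    (forall xi l, eigenvalue (A xi) l -> g l \is Num.real) ->
  max_spectrum_le1 g A <->
  (forall xi, xi \in `[0, 2 * pi] ->
     forall l, eigenvalue (A xi) l -> g l <= 1).
Proof.
move=> A0 g1 g_real; split.
- move=> [rho rho_max [M [_ M_ub] M_le1]] xi xiI l Al.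
  have [_ rho_ub] := rho_max xi xiI.
  apply: le_trans (rho_ub (g l) _) _; first by exists l.
  by apply: le_trans M_le1; apply: M_ub; exists xi.
- move=> g_le1.
  (* [g] has a maximum on the spectrum at every point, also outside [[0, 2 pi]],
     so that [rho] can be obtained by choice without any side condition. *)
  have inner xi : exists m, is_max (g @` spectrum (A xi))%classic m.
    have [z [s As]] := eigenvalue_seq _ _ (A xi).
    have [|m m_s m_max] := real_seq_max _ _ g z s.
      by move=> y; rewrite -As; apply: g_real.
    exists (g m); split.
      by exists m => //; rewrite /spectrum /= -[_ m]/(m \in eigenvalue _) As.
    by move=> _ [y /= Ay <-]; apply: m_max; rewrite -As.
  have [rho rho_max] := choice inner.
  have rho0 : rho 0 = 1.
    have [[l]] := rho_max 0.
    by rewrite /spectrum /= A0 => /eigenvalue_scalar1 -> <-.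
  have I0 : (0 : R) \in `[0, 2 * pi].
    by rewrite in_itv /= lexx mulr_ge0 // pi_ge0.
  exists rho => [xi _|]; first exact: rho_max.
  exists 1 => //; split; first by exists 0.
  move=> _ [xi xiI <-]; have [[l Al <-] _] := rho_max xi.
  exact: g_le1 xiI _ Al.
Qed.

(** * Eigenvalues of 2 x 2 matrices and roots of real quadratics *)

Lemma eigenvalue_mx2 (F : fieldType) (A : 'M[F]_2) (l : F) :
  eigenvalue A l = (l ^+ 2 - \tr A * l + \det A == 0).
Proof.
have c0 := char_poly_det A; have c1 := char_poly_trace A isT.
have c2 := monicP (char_poly_monic A).
rewrite /lead_coef size_char_poly /= in c0 c1 c2.
rewrite eigenvalue_root_char /root horner_coef size_char_poly !big_ord_recr.
rewrite big_ord0 /= c0 c1 c2; congr (_ == 0); ring.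
Qed.

Lemma det_mx2 (F : comRingType) (A : 'M[F]_2) :
  \det A = A 0 0 * A 1 1 - A 0 1 * A 1 0.
Proof.
rewrite (expand_det_row _ 0) !big_ord_recl big_ord0 /cofactor !det_mx11 !mxE /=.
rewrite addr0 expr0 mul1r expr1 mulN1r mulrN.
by congr (_ * _ - _ * _); congr (A _ _); apply: val_inj.
Qed.

(** Separates the real and imaginary parts: either [z] is a real root, or
    [2 * Re z = t], in which case [z] and its conjugate are the two roots. *)
Lemma quad_rootE (R : rcfType) (t d x y : R) :
  ((x +i* y)%C ^+ 2 - t%:C%C * (x +i* y)%C + d%:C%C == 0) =
  (x ^+ 2 - y ^+ 2 - t * x + d == 0) && (y * (2 * x - t) == 0).
Proof.
rewrite eq_complex /= expr2; simpc; rewrite /=.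
congr andb; congr (_ == _); ring.
Qed.

(** Sufficiency in the Schur-Jury criterion.  Non-real roots are conjugate with
    product [d].  For a real root [x] with [1 < x], the value
    [(1 - x) * (1 - (t - x))] at 1 being nonnegative makes the other root
    [t - x] at least 1 too, so that [1 < d]; similarly at -1. *)
Lemma quad_roots_norm_le1 (R : rcfType) (t d : R) (z : R[i]) :
    d <= 1 -> 0 <= 1 - t + d -> 0 <= 1 + t + d ->
  z ^+ 2 - t%:C%C * z + d%:C%C = 0 -> `|z| <= 1.
Proof.
case: z => x y d_le1 p1_ge0 pN1_ge0 /eqP.
rewrite quad_rootE mulf_eq0 => /andP[/eqP px /orP[/eqP y0|/eqP tx]].
- rewrite y0 normc_def /= expr0n addr0 sqrtr_sqr lecR ler_norml.
  apply/andP; split.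
  + rewrite leNgt; apply/negP => x_lt; nra.
  + rewrite leNgt; apply/negP => x_gt; nra.
- rewrite normc_def /= lecR -(@sqrtr1 R) ler_wsqrtr //; nra.
Qed.

Lemma quad_vieta (C : numClosedFieldType) (t d : C) :
  exists z w, [/\ z ^+ 2 - t * z + d = 0, w ^+ 2 - t * w + d = 0,
    z + w = t & z * w = d].
Proof.
pose s := sqrtC (t ^+ 2 - 4 * d).
have sE : s ^+ 2 = t ^+ 2 - 4 * d by exact: sqrtCK.
have dE : d = (t ^+ 2 - s ^+ 2) / 4 by rewrite sE; field.
by exists ((t + s) / 2), ((t - s) / 2); split; rewrite ?dE; field.
Qed.

Lemma quad_roots_prod_le1 (R : rcfType) (t d : R) :
    (forall z : R[i], z ^+ 2 - t%:C%C * z + d%:C%C = 0 -> `|z| <= 1) ->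
  d <= 1.
Proof.
move=> roots_le1; have [z [w [/roots_le1 z1 /roots_le1 w1 _ zw]]] :=
  quad_vieta _ t%:C%C d%:C%C.
have : `|d%:C%C| <= 1 by rewrite -zw normrM mulr_ile1.
rewrite normc_def /= expr0n addr0 sqrtr_sqr lecR.
exact: le_trans (ler_norm _).
Qed.

Lemma quad_root_real (R : rcfType) (t d : R) (z : R[i]) :
  4 * d <= t ^+ 2 -> z ^+ 2 - t%:C%C * z + d%:C%C = 0 -> z \is Num.real.
Proof.
case: z => x y disc /eqP.
rewrite quad_rootE complex_real mulf_eq0.
move=> /andP[/eqP px /orP[//|/eqP tx]].
rewrite -sqrf_eq0; apply/eqP/le_anti; rewrite sqr_ge0 andbT; nra.
Qed.

(** For real roots [z] and [w], [1 - t + d = (1 - z) * (1 - w)] and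
    [2 - t = (1 - z) + (1 - w)]. *)
Lemma quad_real_roots_le1 (R : rcfType) (t d : R) :
    4 * d <= t ^+ 2 ->
  (forall z : R[i], z ^+ 2 - t%:C%C * z + d%:C%C = 0 -> z <= 1) <->
  t <= 2 /\ 0 <= 1 - t + d.
Proof.
move=> disc; split => [roots_le1|[t_le2 p1_ge0] z pz].
- have [z [w [/roots_le1 z1 /roots_le1 w1 zwt zwd]]] :=
    quad_vieta _ t%:C%C d%:C%C.
  split.
  + by rewrite -lecR -zwt; apply: le_trans (lerD z1 w1) _; rewrite rmorph_nat.
  + rewrite -lecR 2!raddfD raddfN /= -zwt -zwd.
    have -> : 1%:C%C - (z + w) + z * w = (1 - z) * (1 - w).
      by rewrite rmorph1; ring.
    by rewrite mulr_ge0 // subr_ge0.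
- have /complex_realP[x zE] := quad_root_real _ _ _ _ disc pz.
  move: pz; rewrite zE => /eqP; rewrite quad_rootE => /andP[/eqP px _].
  rewrite (lecR x 1) leNgt; apply/negP => x_gt; nra.
Qed.

(** * The symbol and its Gram matrix in terms of the half-angle *)

Lemma sqr_sin_half_angle (R : realType) (xi : R) :
  sin xi ^+ 2 = 4 * sin (xi / 2) ^+ 2 * (1 - sin (xi / 2) ^+ 2).
Proof.
rewrite -cos2sin2 {1}(_ : xi = (xi / 2) *+ 2).
  by rewrite sin_mulr2n -mulr_natr; ring.
by rewrite -mulr_natr; field.
Qed.

Lemma sqr_sin_itv01 (R : realType) (y : R) : 0 <= sin y ^+ 2 <= 1.
Proof. by rewrite sqr_ge0 sin2cos2 lerBlDr lerDl sqr_ge0. Qed.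

(** The point [xi = acos (1 - 2 * x)] realizes a given [x], since
    [cos xi = 1 - 2 * sin (xi / 2) ^+ 2]. *)
Lemma forall_sqr_sin_half (R : realType) (P : R -> Prop) :
  (forall xi, xi \in `[0, 2 * pi] -> P (sin (xi / 2) ^+ 2)) <->
  (forall x, 0 <= x <= 1 -> P x).
Proof.
split => [Pxi x /andP[x_ge0 x_le1]|Px xi _].
- have xI : -1 <= 1 - 2 * x <= 1 by apply/andP; split; lra.
  have <- : sin (acos (1 - 2 * x) / 2) ^+ 2 = x.
    have := acosK xI; rewrite {1}(_ : acos _ = (acos (1 - 2 * x) / 2) *+ 2).
      by rewrite cos_mulr2n cos2sin2 -mulr_natr; lra.
    by rewrite -mulr_natr; field.
  apply: Pxi; rewrite in_itv /= acos_ge0 //=; apply: le_trans (acos_lepi xI) _.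
  by have := pi_ge0 R; lra.
- exact/Px/sqr_sin_itv01.
Qed.

(** [symbol_trace] and [symbol_det] are the trace and the determinant of the
    symbol and [gram_trace] is the trace of its Gram matrix, with
    [p = alpha * beta], [q = alpha_s * alpha * beta], [b = beta] and
    [x = sin (xi / 2) ^+ 2]. *)
Definition symbol_trace {R : pzRingType} (p q x : R) : R := 2 - 4 * (p + q) * x.

Definition symbol_det {R : pzRingType} (p q b x : R) : R :=
  (1 - 4 * p * x) * (1 - 4 * q * x) + 4 * b ^+ 2 * x * (1 - x).

Definition gram_trace {R : pzRingType} (p q b x : R) : R :=
  (1 - 4 * p * x) ^+ 2 + (1 - 4 * q * x) ^+ 2 + 8 * b ^+ 2 * x * (1 - x).

Lemma amplification0 (R : realType) (alpha beta alpha_s : R) :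
  amplification alpha beta alpha_s 0 = 1%:M.
Proof.
apply/matrixP => i j; rewrite !mxE /omega1 /omega2 mul0r sin0 expr0n /= !mulr0.
by rewrite subr0; case: eqP; rewrite ?oppr0 //; case: eqP.
Qed.

Lemma det_amplification (R : realType) (alpha beta alpha_s xi : R) :
  \det (amplification alpha beta alpha_s xi) =
  (symbol_det (alpha * beta) (alpha_s * (alpha * beta)) beta
     (sin (xi / 2) ^+ 2))%:C%C.
Proof.
rewrite det_mx2 !mxE /=; simpc; congr (_ %:C)%C; rewrite -expr2.
rewrite /omega1 /omega2 exprMn (sqr_sin_half_angle _ xi) /symbol_det; ring.
Qed.

Lemma eigenvalue_amplification (R : realType) (alpha beta alpha_s xi : R)
    (l : R[i]) :
  let p := alpha * beta in let x := sin (xi / 2) ^+ 2 in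
  eigenvalue (amplification alpha beta alpha_s xi) l <->
  l ^+ 2 - (symbol_trace p (alpha_s * p) x)%:C%C * l
    + (symbol_det p (alpha_s * p) beta x)%:C%C = 0.
Proof.
move=> p x; rewrite eigenvalue_mx2 det_amplification.
suff -> : \tr (amplification alpha beta alpha_s xi) =
    (symbol_trace p (alpha_s * p) x)%:C%C by split=> /eqP.
rewrite /mxtrace !big_ord_recr big_ord0 /= add0r !mxE /= -raddfD /=.
by rewrite /omega1 /symbol_trace; congr (_ %:C)%C; rewrite -/x /p; ring.
Qed.

Lemma conjC_complex (R : rcfType) (a b : R) :
  Num.conj (a +i* b)%C = (a -i* b)%C.
Proof. by []. Qed.

Lemma conjC_realC (R : rcfType) (a : R) : Num.conj a%:C%C = a%:C%C.
Proof. by rewrite conjC_complex oppr0. Qed.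

(** The determinant of the symbol is real although its entries are not, so the
    determinant of the Gram matrix is its square. *)
Lemma eigenvalue_gram (R : realType) (alpha beta alpha_s xi : R)
    (l : R[i]) :
  let p := alpha * beta in let x := sin (xi / 2) ^+ 2 in
  let G := amplification alpha beta alpha_s xi in
  eigenvalue ((G ^t* )%sesqui *m G) l <->
  l ^+ 2 - (gram_trace p (alpha_s * p) beta x)%:C%C * l
    + (symbol_det p (alpha_s * p) beta x ^+ 2)%:C%C = 0.
Proof.
move=> p x G; rewrite eigenvalue_mx2.
have -> : \det ((G ^t* )%sesqui *m G) =
    (symbol_det p (alpha_s * p) beta x ^+ 2)%:C%C.
  rewrite det_mulmx det_map_mx det_tr det_amplification rmorphXn expr2.
  by congr (_ * _); apply: conjC_realC.
suff -> : \tr ((G ^t* )%sesqui *m G) =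
    (gram_trace p (alpha_s * p) beta x)%:C%C by split=> /eqP.
rewrite /mxtrace !big_ord_recr big_ord0 /= add0r !mxE.
rewrite !big_ord_recr !big_ord0 /= !add0r !mxE /=.
rewrite !conjC_complex; simpc; congr (_ %:C)%C; rewrite -!expr2.
rewrite /omega1 /omega2 exprMn (sqr_sin_half_angle _ xi) -/x /gram_trace /p.
ring.
Qed.

(** The discriminant of the Gram matrix factors through
    [gram_trace -/+ 2 * symbol_det]: with [w = b * sin xi], diagonal entries
    [a], [c] and determinant [a * c + w ^+ 2] of the symbol, these are
    [(a - c) ^+ 2] and [(a + c) ^+ 2 + 4 * w ^+ 2]. *)
Lemma gram_disc_ge0 (R : realDomainType) (p q b x : R) :
  0 <= x <= 1 -> 4 * symbol_det p q b x ^+ 2 <= gram_trace p q b x ^+ 2.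
Proof.
move=> /andP[x_ge0 x_le1]; rewrite -subr_ge0.
have -> : gram_trace p q b x ^+ 2 - 4 * symbol_det p q b x ^+ 2 =
    (4 * (p - q) * x) ^+ 2 *
    ((2 - 4 * (p + q) * x) ^+ 2 + 16 * b ^+ 2 * (x * (1 - x))).
  by rewrite /gram_trace /symbol_det; ring.
have x1x_ge0 : 0 <= x * (1 - x) by rewrite mulr_ge0 ?subr_ge0.
rewrite mulr_ge0 ?sqr_ge0 // addr_ge0 ?sqr_ge0 //.
by rewrite mulr_ge0 // mulr_ge0 ?sqr_ge0.
Qed.

(** * The two stability conditions *)

Lemma cond_NE (R : realType) (alpha beta alpha_s : R) :
  let p := alpha * beta in let q := alpha_s * p in
  cond_N alpha beta alpha_s <->
  forall x, 0 <= x <= 1 -> forall z : R[i],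
    z ^+ 2 - (symbol_trace p q x)%:C%C * z + (symbol_det p q beta x)%:C%C = 0 ->
    `|z| <= 1.
Proof.
move=> p q; apply: iff_trans.
  apply: max_spectrum_le1P; [exact: amplification0 | exact: normr1 |].
  by move=> xi l _; apply: normr_real.
rewrite -forall_sqr_sin_half.
by split=> le1 xi xiI z /eigenvalue_amplification zE; apply: le1 zE.
Qed.

Lemma cond_CE (R : realType) (alpha beta alpha_s : R) :
  let p := alpha * beta in let q := alpha_s * p in
  cond_C alpha beta alpha_s <->
  forall x, 0 <= x <= 1 ->
    gram_trace p q beta x <= 2 /\
    0 <= 1 - gram_trace p q beta x + symbol_det p q beta x ^+ 2.
Proof.
move=> p q; apply: iff_trans.
  apply: max_spectrum_le1P => //.
  - rewrite amplification0 mulmx1 trmx1 map_mx1 //.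
  - move=> xi l /eigenvalue_gram; apply: quad_root_real.
    exact/gram_disc_ge0/sqr_sin_itv01.
rewrite -forall_sqr_sin_half.
have disc xi := gram_disc_ge0 _ p q beta _ (sqr_sin_itv01 R (xi / 2)).
split=> le1 xi xiI.
- apply/(quad_real_roots_le1 _ _ _ (disc xi)) => z /eigenvalue_gram.
  exact: le1.
- move=> z /eigenvalue_gram; move: z.
  exact/(quad_real_roots_le1 _ _ _ (disc xi))/le1.
Qed.

(** The form in which [x] tends to 0: the bounds are obtained after division by
    a factor vanishing at [x = 0], hence only for positive [x]. *)
Lemma affine_ge0P (R : realFieldType) (u v : R) :
  (forall x, 0 < x <= 1 -> 0 <= (1 - x) * u + x * v) <-> 0 <= u /\ 0 <= v.
Proof.
split=> [ge0|[u_ge0 v_ge0] x /andP[x_gt0 x_le1]]; last first.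
  by rewrite addr_ge0 // mulr_ge0 ?subr_ge0 // ltW.
have v_ge0 : 0 <= v.
  by have := ge0 1; rewrite ltr01 lexx subrr mul0r mul1r add0r => ->.
split=> //; rewrite leNgt; apply/negP => u_lt0.
have vu_gt0 : 0 < v - u by lra.
(* Half of the zero of the affine function. *)
pose x := - u / (2 * (v - u)).
have x_itv : 0 < x <= 1.
  by rewrite divr_gt0 ?ler_pdivrMr /=; lra.
have xE : (1 - x) * u + x * v = u / 2 by rewrite /x; field; lra.
by have := ge0 x x_itv; rewrite xE; lra.
Qed.

Lemma symbol_roots_le1P (R : rcfType) (p q b : R) : 0 <= p -> 0 <= q ->
  (forall x, 0 <= x <= 1 -> forall z : R[i],
     z ^+ 2 - (symbol_trace p q x)%:C%C * z + (symbol_det p q b x)%:C%C = 0 ->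
     `|z| <= 1) <->
  [/\ b ^+ 2 <= p + q, 2 * p <= 1 & 2 * q <= 1].
Proof.
move=> p_ge0 q_ge0.
have dE x : 1 - symbol_det p q b x =
    4 * x * ((1 - x) * (p + q - b ^+ 2) + x * (p + q - 4 * p * q)).
  by rewrite /symbol_det; ring.
split=> [roots_le1|[b_le p_le q_le] x /andP[x_ge0 x_le1] z].
(* At [x = 1] the off-diagonal entries vanish. *)
- have diag (r : R) : r = p \/ r = q -> 2 * r <= 1.
    move=> rpq; have := roots_le1 1 _ (1 - 4 * r)%:C%C.
    rewrite ler01 lexx => /(_ isT).
    rewrite normc_def /= expr0n addr0 sqrtr_sqr lecR ler_norml.
    move=> /(_ _)/wrap[|/andP[]]; last lra.
    apply/eqP; rewrite quad_rootE mul0r eqxx andbT expr0n /=.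
    by rewrite /symbol_trace /symbol_det; case: rpq => ->; apply/eqP; ring.
  split; [|by apply: diag; left|by apply: diag; right].
  suff [] : 0 <= p + q - b ^+ 2 /\ 0 <= p + q - 4 * p * q by lra.
  apply/affine_ge0P => x /andP[x_gt0 x_le1].
  have := quad_roots_prod_le1 _ _ _ (roots_le1 x _).
  rewrite (ltW x_gt0) x_le1 => /(_ isT).
  by rewrite -subr_ge0 dE pmulr_rge0 // mulr_gt0.
- have b2x_ge0 : 0 <= b ^+ 2 * (x * (1 - x)).
    by rewrite mulr_ge0 ?sqr_ge0 // mulr_ge0 // subr_ge0.
  apply: quad_roots_norm_le1.
  + rewrite -subr_ge0 dE.
    have U_ge0 : 0 <= p + q - b ^+ 2 by lra.
    have V_ge0 : 0 <= p + q - 4 * p * q by nra.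
    by rewrite mulr_ge0 ?mulr_ge0 // addr_ge0 // mulr_ge0 // subr_ge0.
  + have -> : 1 - symbol_trace p q x + symbol_det p q b x =
      16 * (p * q * x ^+ 2) + 4 * (b ^+ 2 * (x * (1 - x))).
      by rewrite /symbol_trace /symbol_det; ring.
    by rewrite addr_ge0 // mulr_ge0 // mulr_ge0 ?mulr_ge0 ?sqr_ge0.
  + have -> : 1 + symbol_trace p q x + symbol_det p q b x =
      4 * ((1 - 2 * p * x) * (1 - 2 * q * x)) + 4 * (b ^+ 2 * (x * (1 - x))).
      by rewrite /symbol_trace /symbol_det; ring.
    rewrite addr_ge0 // mulr_ge0 // mulr_ge0 // subr_ge0; nra.
Qed.

Lemma gram_boundP (R : realFieldType) (p q b : R) : 0 <= p -> 0 <= q ->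
  (forall x, 0 <= x <= 1 -> gram_trace p q b x <= 2 /\
     0 <= 1 - gram_trace p q b x + symbol_det p q b x ^+ 2) <->
  [/\ b ^+ 2 <= 2 * p, b ^+ 2 <= 2 * q, 2 * p <= 1 & 2 * q <= 1].
Proof.
move=> p_ge0 q_ge0.
pose D r x : R := (1 - x) * (2 * r - b ^+ 2) + x * (2 * r * (1 - 2 * r)).
have TE x : 2 - gram_trace p q b x = 4 * x * (D p x + D q x).
  by rewrite /gram_trace /D; ring.
have dE x : 1 - gram_trace p q b x + symbol_det p q b x ^+ 2 =
    (4 * x) ^+ 2 * (D p x * D q x - 4 * (b * (p - q)) ^+ 2 * (x * (1 - x))).
  by rewrite /gram_trace /symbol_det /D; ring.
split=> [bound|[bp bq p_le q_le] x /andP[x_ge0 x_le1]].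
- have D_ge0 x : 0 < x <= 1 -> 0 <= D p x /\ 0 <= D q x.
    move=> /andP[x_gt0 x_le1].
    have [] := bound x; first by rewrite ltW.
    rewrite -subr_ge0 TE dE pmulr_rge0 ?mulr_gt0 //.
    rewrite pmulr_rge0 ?exprn_gt0 ?mulr_gt0 // subr_ge0 => sum_ge0 prod_ge.
    have prod_ge0 : 0 <= D p x * D q x.
      have x1x_ge0 : 0 <= x * (1 - x) by rewrite mulr_ge0 ?subr_ge0 // ltW.
      by apply: le_trans prod_ge; rewrite mulr_ge0 // mulr_ge0 // sqr_ge0.
    (* The sum and the product of the two numbers are nonnegative. *)
    by split; nra.
  have /affine_ge0P[] : forall x, 0 < x <= 1 -> 0 <= D p x.
    by move=> x /D_ge0[].
  have /affine_ge0P[] : forall x, 0 < x <= 1 -> 0 <= D q x.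
    by move=> x /D_ge0[].
  move=> bq qq bp pp; split; nra.
- have r_ge0 (r : R) : 0 <= r -> 2 * r <= 1 -> 0 <= 2 * r * (1 - 2 * r).
    by move=> ? ?; rewrite !mulr_ge0 // subr_ge0.
  have D_ge0 (r : R) : 0 <= r -> 2 * r <= 1 -> b ^+ 2 <= 2 * r -> 0 <= D r x.
    by move=> ? ? ?; rewrite addr_ge0 ?mulr_ge0 ?r_ge0 ?subr_ge0.
  split; first by rewrite -subr_ge0 TE !mulr_ge0 // addr_ge0 // D_ge0.
  rewrite dE mulr_ge0 ?sqr_ge0 //.
  (* This makes the coefficient of [x * (1 - x)] nonnegative. *)
  have cross : 4 * (b * (p - q)) ^+ 2 <=
      (2 * p - b ^+ 2) * (2 * q * (1 - 2 * q)) +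
      (2 * p * (1 - 2 * p)) * (2 * q - b ^+ 2).
    (* The difference of the two sides is affine in [b ^+ 2], and for
       [q <= p] it is nonnegative at both ends [0] and [2 * q] of the range of
       [b ^+ 2]; the identity below is its interpolation between them. *)
    wlog qp : p q p_ge0 q_ge0 p_le q_le bp bq {D TE dE D_ge0} / q <= p.
      move=> IH; case: (leP q p) => [|/ltW] pq; first exact: IH.
      by have := IH q p q_ge0 p_ge0 q_le p_le bq bp pq; lra.
    rewrite -subr_ge0.
    have -> : (2 * p - b ^+ 2) * (2 * q * (1 - 2 * q)) +
        2 * p * (1 - 2 * p) * (2 * q - b ^+ 2) - 4 * (b * (p - q)) ^+ 2 =
        4 * p * (1 - p - q) * (2 * q - b ^+ 2) +
        2 * b ^+ 2 * (p - q) * (1 - 2 * p).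
      by ring.
    have b2_ge0 := sqr_ge0 b.
    by rewrite addr_ge0 // mulr_ge0 ?[0 <= _ - _]subr_ge0 // mulr_ge0; lra.
  have -> : D p x * D q x - 4 * (b * (p - q)) ^+ 2 * (x * (1 - x)) =
     (1 - x) ^+ 2 * ((2 * p - b ^+ 2) * (2 * q - b ^+ 2)) +
     x ^+ 2 * ((2 * p * (1 - 2 * p)) * (2 * q * (1 - 2 * q))) +
     x * (1 - x) * ((2 * p - b ^+ 2) * (2 * q * (1 - 2 * q)) +
      (2 * p * (1 - 2 * p)) * (2 * q - b ^+ 2) - 4 * (b * (p - q)) ^+ 2).
    by rewrite /D; ring.
  rewrite addr_ge0 // ?addr_ge0 // mulr_ge0 ?sqr_ge0 //.
  + by rewrite mulr_ge0 // subr_ge0.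
  + by rewrite mulr_ge0 // r_ge0.
  + by rewrite mulr_ge0 // subr_ge0.
  + by rewrite subr_ge0.
Qed.

Theorem theorem3 (R : realType) (alpha beta alpha_s : R)
    (alpha_gt0 : 0 < alpha) (beta_gt0 : 0 < beta) (alpha_s_ge0 : 0 <= alpha_s) :
  (0 <= alpha_s <= 1 ->
    (cond_N alpha beta alpha_s <->
       beta <= Num.min ((alpha_s + 1) * alpha) (1 / (2 * alpha))) /\
    (cond_C alpha beta alpha_s <->
       beta <= Num.min (2 * alpha_s * alpha) (1 / (2 * alpha)))) /\
  (1 <= alpha_s ->
    (cond_N alpha beta alpha_s <->
       beta <= Num.min ((alpha_s + 1) * alpha) (1 / (2 * alpha_s * alpha))) /\
    (cond_C alpha beta alpha_s <->
       beta <= Num.min (2 * alpha) (1 / (2 * alpha_s * alpha)))).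
Proof.
set p := alpha * beta; set q := alpha_s * p.
have p_gt0 : 0 < p by rewrite mulr_gt0.
have q_ge0 : 0 <= q by rewrite mulr_ge0 // ltW.
have NP : cond_N alpha beta alpha_s <->
    [/\ beta ^+ 2 <= p + q, 2 * p <= 1 & 2 * q <= 1].
  apply: iff_trans (cond_NE _ _ _ _) _.
  exact: symbol_roots_le1P (ltW p_gt0) q_ge0.
have CP : cond_C alpha beta alpha_s <->
    [/\ beta ^+ 2 <= 2 * p, beta ^+ 2 <= 2 * q, 2 * p <= 1 & 2 * q <= 1].
  exact: iff_trans (cond_CE _ _ _ _) (gram_boundP _ _ _ _ (ltW p_gt0) q_ge0).
have pqE : (beta ^+ 2 <= p + q) = (beta <= (alpha_s + 1) * alpha).
  rewrite -[RHS](ler_pM2r beta_gt0) -expr2; congr (_ <= _); rewrite /q /p; ring.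
have pE : (beta ^+ 2 <= 2 * p) = (beta <= 2 * alpha).
  by rewrite /p mulrA expr2 ler_pM2r.
have qE : (beta ^+ 2 <= 2 * q) = (beta <= 2 * alpha_s * alpha).
  by rewrite /q /p !mulrA expr2 ler_pM2r.
have p1E : (beta <= 1 / (2 * alpha)) = (2 * p <= 1).
  by rewrite ler_pdivlMr ?mulr_gt0 // /p; congr (_ <= _); ring.
split=> [/andP[_ as_le1]|as_ge1].
- have qp : q <= p by rewrite /q ler_piMl // ltW.
  rewrite NP CP !le_min -pqE -?pE -?qE p1E; split; split.
  + by case=> -> ->.
  + by move=> /andP[-> p_le]; split=> //; lra.
  + by case=> _ -> ->.
  + by move=> /andP[bq p_le]; split=> //; lra.
- have qp : p <= q by rewrite /q ler_peMl // ltW.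
  have q1E : (beta <= 1 / (2 * alpha_s * alpha)) = (2 * q <= 1).
    rewrite ler_pdivlMr ?mulr_gt0 //; last exact: lt_le_trans as_ge1.
    by rewrite /q /p; congr (_ <= _); ring.
  rewrite NP CP !le_min -pqE -?pE -?qE q1E; split; split.
  + by case=> -> _ ->.
  + by move=> /andP[-> q_le]; split=> //; lra.
  + by case=> -> _ _ ->.
  + by move=> /andP[bp q_le]; split=> //; lra.
Qed.
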